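(* Let $d\in\mathbb{N}$. Let $\boldsymbol{U}=(U_1,\dots,U_d)$ be a random vector following an arbitrary copula $C$, and let $\boldsymbol{V}=(V_1,\dots,V_d)$ be a random vector following a GPD-copula with generator $\boldsymbol{Z}=(Z_1,\dots,Z_d)$, with $\boldsymbol{U}$ and $\boldsymbol{V}$ independent. Choose a threshold $\boldsymbol{u}=(u_1,\dots,u_d)\in(0,1)^d$ and put, for $1\le i\le d$, $$Y_i:=U_i\,\mathbf{1}(U_i\le u_i)+\{u_i+(1-u_i)V_i\}\,\mathbf{1}(U_i>u_i).$$ Suppose that $\mathrm{P}(\boldsymbol{U}>\boldsymbol{u})>0$. Then the random vector $\boldsymbol{Y}=(Y_1,\dots,Y_d)$ follows a GPD-copula, this copula coincides with $C$ on $[\boldsymbol{0},\boldsymbol{u}]$, and its $D$-norm is given by $$\|\boldsymbol{x}\|_D=\mathrm{E}\left[\max_{1\le j\le d}\left\{|x_j|\,Z_j\,\frac{\mathbf{1}(U_j>u_j)}{1-u_j}\right\}\right],\qquad \boldsymbol{x}\in\mathbb{R}^d,$$ where $\boldsymbol{Z}$ and $\boldsymbol{U}$ are independent.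
   Context: All operations and inequalities between vectors are componentwise; $\boldsymbol{0}=(0,\dots,0)$, $\boldsymbol{1}=(1,\dots,1)$ in $\mathbb{R}^d$; $\mathbf{1}(A)$ is the indicator of the event $A$. A $D$-norm on $\mathbb{R}^d$ is a norm of the form $\|\boldsymbol{x}\|_D=\mathrm{E}\{\max_{1\le i\le d}(|x_i|Z_i)\}$, where $\boldsymbol{Z}=(Z_1,\dots,Z_d)$ is a random vector with $\boldsymbol{Z}\in[0,c]^d$ for some $c>0$ and $\mathrm{E}(Z_i)=1$ for $1\le i\le d$; such a $\boldsymbol{Z}$ is called a generator of $\|\cdot\|_D$ (it is not unique). A copula $C$ on $[0,1]^d$ is called a GPD-copula if there exist $\boldsymbol{u}_0<\boldsymbol{1}$ in $\mathbb{R}^d$ and a $D$-norm $\|\cdot\|_D$ such that $C(\boldsymbol{w})=1-\|\boldsymbol{w}-\boldsymbol{1}\|_D$ for all $\boldsymbol{u}_0\le\boldsymbol{w}\le\boldsymbol{1}$ (with $\boldsymbol{w}\in[0,1]^d$). In this case $\|\cdot\|_D$ is called the $D$-norm of the GPD-copula, and a generator $\boldsymbol{Z}$ of $\|\cdot\|_D$ is called a generator of the GPD-copula. *)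

(* Defs.v *)
From HB Require Import structures.
From mathcomp Require Import all_boot all_order all_algebra.
From mathcomp Require Import all_classical all_reals all_analysis.
From mathcomp Require Import measurable_realfun.

Set Implicit Arguments.
Unset Strict Implicit.
Unset Printing Implicit Defensive.

Import Order.TTheory GRing.Theory Num.Theory.
Import numFieldNormedType.Exports.

Local Open Scope classical_set_scope.
Local Open Scope ring_scope.

(* A random vector is a family [X : 'I_n -> {RV P >-> R}]; a point of R^n is a
   row vector [x : 'rV[R]_n] with components [x 0 i]. *)

(* The sigma-algebra of a random vector is [g_sigma_preimage X], which is
   generated by the events [X i \in B] with B Borel, so this is the usual
   P(X \in A, Y \in B) = P(X \in A) P(Y \in B) for Borel subsets A, B of R^n. *)
Definition independent_vectors (R : realType) (d : measure_display)
    (T : measurableType d) (P : probability T R) (n : nat)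
    (X Y : 'I_n -> {RV P >-> R}) : Prop :=
  forall A B : set T,
    g_sigma_preimage (fun i => X i : T -> R) A ->
    g_sigma_preimage (fun i => Y i : T -> R) B ->
    P (A `&` B) = (P A * P B)%E.

Definition unit_cube (R : realType) (n : nat) : set 'rV[R]_n :=
  [set w | forall i, 0 <= w 0 i <= 1].

(* The joint distribution function of X is C on [0,1]^n; values of C outside of
   the cube are irrelevant throughout. *)
Definition follows (R : realType) (d : measure_display)
    (T : measurableType d) (P : probability T R) (n : nat)
    (X : 'I_n -> {RV P >-> R}) (C : 'rV[R]_n -> R) : Prop :=
  forall w, unit_cube w -> P [set t | forall i, X i t <= w 0 i] = (C w)%:E.

Definition copula (R : realType) (n : nat) (C : 'rV[R]_n -> R) : Prop :=
  exists (d : measure_display) (T : measurableType d) (P : probability T R)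
         (X : 'I_n -> {RV P >-> R}),
    (forall i A, measurable A ->
       distribution P (X i) A = uniform_prob (@ltr01 R) A) /\
    follows X C.

Definition is_norm (R : realType) (n : nat) (N : 'rV[R]_n -> R) : Prop :=
  [/\ forall x y, N (x + y) <= N x + N y,
      forall a x, N (a *: x) = `|a| * N x &
      forall x, N x = 0 -> x = 0].

(* The unit 0 of the iterated maximum is harmless for n > 0, as the terms are
   almost surely nonnegative. *)
Definition Dnorm_generator (R : realType) (d : measure_display)
    (T : measurableType d) (P : probability T R) (n : nat)
    (Z : 'I_n -> {RV P >-> R}) (N : 'rV[R]_n -> R) : Prop :=
  [/\ exists2 c : R, 0 < c & {ae P, forall t, forall i, 0 <= Z i t <= c},
      forall i, 'E_P[Z i]%E = 1%E &
      forall x, (N x)%:E =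
        'E_P[fun t => (\big[Order.max/0]_(i < n) (`|x 0 i| * Z i t))%R]%E].

Definition Dnorm (R : realType) (n : nat) (N : 'rV[R]_n -> R) : Prop :=
  is_norm N /\
  exists (d : measure_display) (T : measurableType d) (P : probability T R)
         (Z : 'I_n -> {RV P >-> R}), Dnorm_generator Z N.

(* C is a GPD-copula and N is its D-norm. *)
Definition gpd_copula (R : realType) (n : nat) (C N : 'rV[R]_n -> R) : Prop :=
  [/\ copula C, Dnorm N &
      exists2 u0 : 'rV[R]_n, (forall i, u0 0 i < 1) &
        forall w, unit_cube w -> (forall i, u0 0 i <= w 0 i) ->
          C w = 1 - N (w - const_mx 1)].

Section splice.
Context (R : realType) (d : measure_display) (T : measurableType d).

Definition splice (a : R) (X W : {mfun T >-> R}) (t : T) : R :=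
  X t * (X t <= a)%R%:R + (a + (1 - a) * W t) * (a < X t)%R%:R.

Lemma measurable_splice (a : R) (X W : {mfun T >-> R}) :
  measurable_fun setT (splice a X W).
Proof.
have mX : measurable_fun setT X by [].
have -> : splice a X W =
    (fun t => if X t <= a then X t else a + (1 - a) * W t).
  by apply/funext => t; rewrite /splice; case: leP => _;
    rewrite ?(mulr1, mulr0, addr0, add0r).
apply: measurable_fun_ifT => //=.
  by apply: measurable_fun_ler => //; exact: measurable_cst.
apply: measurable_funD; first exact: measurable_cst.
by apply: measurable_funM => //; exact: measurable_cst.
Qed.

HB.instance Definition _ (a : R) (X W : {mfun T >-> R}) :=
  isMeasurableFun.Build _ _ _ _ (splice a X W) (measurable_splice a X W).

End splice.

Definition splice_vector (R : realType) (d : measure_display)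
    (T : measurableType d) (P : probability T R) (n : nat)
    (u : 'rV[R]_n) (U V : 'I_n -> {RV P >-> R}) : 'I_n -> {RV P >-> R} :=
  fun i => splice (u 0 i) (U i) (V i) : {RV P >-> R}.

(* Main.v *)
Require Import Defs.
From HB Require Import structures.
From mathcomp Require Import all_boot all_order all_algebra.
From mathcomp Require Import all_classical all_reals all_analysis.
From mathcomp Require Import measurable_realfun.

Import Order.TTheory GRing.Theory Num.Theory.
Import numFieldNormedType.Exports.

Local Open Scope classical_set_scope.
Local Open Scope ring_scope.

(** Let J(t) be the random set of coordinates j in which U exceeds u
    ([exceed]).  Given J, the vector Y is pieced together from the components
    of U outside J and from rescaled components of V inside J, and V is
    independent of J because J is a function of U.  Everything follows by
    conditioning on the finitely many values of J ([total_probability],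
    [total_integral]).

    Margins.  The variable Y_i lies below u_i exactly when U_i does (as V_i > 0
    almost surely), where it equals U_i; above u_i it is an independent uniform
    variable rescaled to [u_i, 1].  Hence its distribution function is the
    identity on [0,1] ([splice_margin]), so that Y has a copula
    ([splice_copula]).  The same remark, made for all the coordinates together,
    gives the agreement with C on [0,u] ([splice_below]).

    Upper tail.  For w >= u the event Y <= w says that
    V_j <= v_j := (w_j - u_j) / (1 - u_j) for every j in J.  On {J = K} its
    conditional probability is the value of the GPD-copula of V at the point
    with coordinates v_j in K and 1 outside K ([splice_above]).  If w is close
    to 1 this is one minus the D-norm of V at the vector
    (w_j - 1) / (1 - u_j) 1(j in K) ([rescale_on]).  Averaging over K, the
    distribution function of Y is w |-> 1 - N(w - 1) near the upper corner,
    where N is the mixture over K of these D-norms, weighted by P(J = K)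
    ([mixture_norm]).

    The mixture.  N is a norm since each term is a seminorm and the term of
    the full set, which has positive weight, is definite ([is_norm_mixture]).
    The independence of U and Z turns the mixture into the expectation
    E[max_j |x_j| Z_j 1(U_j > u_j) / (1 - u_j)]
    ([mixture_norm_expectation]), and the variables
    Z_j 1(U_j > u_j) / (1 - u_j) are bounded with mean
    P(U_j > u_j) / (1 - u_j) = 1; they generate N ([Dnorm_mixture]). *)

(** * Null sets and the uniform law *)

Section null_sets.
Context {R : realType} {d : measure_display} {T : measurableType d}
  {P : probability T R}.

Lemma ae_probability_eq (A B : set T) : measurable A -> measurable B ->
  {ae P, forall t, A t <-> B t} -> P A = P B.
Proof.
move=> mA mB AB.
rewrite -(setIT A) -(setIT B) -!integral_indic//.
apply: ge0_ae_eq_integral => //.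
- by apply/measurable_EFinP; exact: measurable_indic.
- by apply/measurable_EFinP; exact: measurable_indic.
apply: filterS AB => t ABt _ /=; rewrite !indicE; congr (_%:R%:E).
by congr nat_of_bool; apply/idP/idP; rewrite !inE => /ABt.
Qed.

Lemma probability1_ae (A : set T) :
  measurable A -> P A = 1%E -> {ae P, forall t, A t}.
Proof.
move=> mA PA; exists (~` A); split => //; first exact: measurableC.
by rewrite probability_setC// PA subee.
Qed.

End null_sets.

Section uniform_law.
Context {R : realType}.

Lemma uniform_prob_itvNyc (a : R) : 0 <= a <= 1 ->
  uniform_prob (@ltr01 R) `]-oo, a] = a%:E.
Proof.
move=> /andP[a0 a1]; rewrite /uniform_prob integral_uniform_pdf.
have -> : (`]-oo, a]%classic `&` `[0, 1]%classic = `[0, a]%classic :> set R).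
  apply/seteqP; split => x /=; rewrite !in_itv /=.
    by move=> [-> /andP[-> _]].
  by move=> /andP[x0 xa]; rewrite xa x0 (le_trans xa a1).
rewrite (eq_integral (cst 1%E)); last first.
  move=> x; rewrite inE/= in_itv/= => /andP[x0 xa].
  by rewrite /uniform_pdf x0 (le_trans xa a1)/= subr0 invr1.
rewrite integral_cst// mul1e.
rewrite [LHS](lebesgue_measure_itv `[0, a])/= lte_fin.
case: ltP => [_|a0']; first by rewrite sube0.
by congr (_%:E); apply/le_anti/andP.
Qed.

Context {d : measure_display} {T : measurableType d} {P : probability T R}.

(** A law on the line is determined by its distribution function, and one that
    is the identity on [0,1] has no room left outside of it: monotonicity
    forces the values 0 below and 1 above. *)
Lemma distribution_uniform (X : {RV P >-> R}) :
    (forall a : R, 0 <= a <= 1 -> P [set t | X t <= a] = a%:E) ->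
  forall A, measurable A -> distribution P X A = uniform_prob (@ltr01 R) A.
Proof.
move=> cdfX.
(* The uniform law lives on [measurableTypeR R], whose display differs from
   that of [R]; X is retyped so that both laws are measures on one type. *)
have mX : measurable_fun setT (X : T -> measurableTypeR R).
  exact: (measurable_funPT X).
pose X' : {mfun T >-> measurableTypeR R} :=
  HB.pack (X : T -> measurableTypeR R) (isMeasurableFun.Build _ _ _ _ _ mX).
pose Q1 : probability (measurableTypeR R) R := distribution P X'.
pose Q2 : probability (measurableTypeR R) R := uniform_prob (@ltr01 R).
have cdf1 (a : R) : 0 <= a <= 1 -> Q1 `]-oo, a]%classic = a%:E.
  move=> /cdfX <-; apply: (congr1 (P : set T -> \bar R)).
  by apply/seteqP; split => t; rewrite /= in_itv.
have cdf2 (a : R) : 0 <= a <= 1 -> Q2 `]-oo, a]%classic = a%:E.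
  exact: uniform_prob_itvNyc.
have cdf_clamp (Q : probability (measurableTypeR R) R) (a : R) :
    (forall a : R, 0 <= a <= 1 -> Q `]-oo, a]%classic = a%:E) ->
    Q `]-oo, a]%classic = (Order.max 0 (Order.min a 1))%:E.
  move=> cdfQ; have [a0|a0] := ltP a 0.
    rewrite (min_idPl (le_trans (ltW a0) ler01)) (max_idPl (ltW a0)).
    apply/eqP; rewrite eq_le measure_ge0 andbT -(cdfQ 0) ?lexx ?ler01//.
    by apply: le_measure; rewrite ?inE//; apply: subset_itvl;
      rewrite bnd_simp ltW.
  have [a1|a1] := leP a 1; first by rewrite (max_idPr a0) cdfQ ?a0 ?a1.
  rewrite (max_idPr ler01); apply/eqP; rewrite eq_le probability_le1//=.
  rewrite -[leLHS](cdfQ 1) ?lexx ?ler01//.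
  by apply: le_measure; rewrite ?inE//; apply: subset_itvl;
    rewrite bnd_simp ltW.
move=> A mA; rewrite -[LHS]/(Q1 A) -[RHS]/(Q2 A).
apply: (@measure_unique _ R (measurableTypeR R) (@RGenOInfty.G R)
  (fun k => `]- k%:R, +oo[%classic) _ _ _ _ Q1 Q2) => //.
- exact: RGenOInfty.measurableE.
- move=> _ _ [x ->] [y ->]; exists (Order.max x y).
  apply/seteqP; split => z /=; rewrite !in_itv/= !andbT gt_max.
    by move=> [-> ->].
  by move=> /andP[].
- by move=> k; exists (- k%:R).
- apply/seteqP; split => // x _; exists (Num.bound `|x|) => //=.
  rewrite in_itv/= andbT ltrNl (le_lt_trans (ler_norm _))// normrN.
  exact/archi_boundP/normr_ge0.
- move=> _ [x ->].
  have compl (Q : probability (measurableTypeR R) R) :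
      Q `]x, +oo[%classic = (1 - Q `]-oo, x]%classic)%E.
    by rewrite -probability_setC// setCitvl.
  by rewrite [LHS](compl Q1) [RHS](compl Q2)
    (cdf_clamp Q1)// (cdf_clamp Q2).
- by move=> k; rewrite (le_lt_trans (probability_le1 _ _)) ?ltry.
Qed.

End uniform_law.

(** * Measurable events *)

Section measurable_events.
Context {R : realType} {d : measure_display} {T : measurableType d}.

Lemma measurable_set_le (f : T -> R) (a : R) :
  measurable_fun setT f -> measurable [set t | f t <= a].
Proof.
move=> mf; have := mf measurableT _ (measurable_itv `]-oo, a]).
by rewrite setTI; congr measurable.
Qed.

Lemma measurable_set_gt (f : T -> R) (a : R) :
  measurable_fun setT f -> measurable [set t | a < f t].
Proof.
move=> /(measurable_set_le _ a)/measurableC; congr measurable.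
apply/seteqP; split => t /=; first by move/negP; rewrite -ltNge.
by rewrite ltNge => /negP.
Qed.

Lemma measurable_finite_forall (I : finType) (Q : I -> T -> Prop) :
  (forall i, measurable [set t | Q i t]) ->
  measurable [set t | forall i, Q i t].
Proof.
move=> mQ.
have -> : [set t | forall i, Q i t] = \bigcap_(i in setT) [set t | Q i t].
  by apply/seteqP; split => t /= Qt i => [_|]; apply: Qt.
by apply: fin_bigcap_measurable => // i _; exact: mQ.
Qed.

Context {n : nat}.

Definition exceed (a : 'I_n -> R) (X : 'I_n -> T -> R) (t : T) : {set 'I_n} :=
  [set j | a j < X j t]%SET.

Lemma measurable_exceed (a : 'I_n -> R) (X : 'I_n -> T -> R) (J : {set 'I_n}) :
  (forall i, measurable_fun setT (X i)) ->
  measurable [set t | exceed a X t = J].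
Proof.
move=> mX.
have -> : [set t | exceed a X t = J] =
    [set t | forall j, (a j < X j t) = (j \in J)].
  apply/seteqP; split => t /=; first by move=> <- j; rewrite inE.
  by move=> XJ; apply/setP => j; rewrite inE.
apply: measurable_finite_forall => j.
case: (j \in J); first exact: measurable_set_gt.
have := measurable_set_le _ (a j) (mX j); congr measurable.
by apply/seteqP; split => t /=; rewrite leNgt; [move/negbTE|move=> ->].
Qed.

Lemma measurable_bigmax_scaled (x : 'I_n -> R) (X : 'I_n -> T -> R) :
  (forall i, measurable_fun setT (X i)) ->
  measurable_fun setT (fun t => \big[Order.max/0]_(i < n) (x i * X i t)).
Proof.
move=> mX; elim: (index_enum _) => [|i s ih].
  by under eq_fun do rewrite big_nil; exact: measurable_cst.
under eq_fun do rewrite big_cons.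
apply: measurable_maxr => //.
by apply: measurable_funM => //; exact: measurable_cst.
Qed.

End measurable_events.

Section sigma_generated.
Context {R : realType} {d : measure_display} {T : measurableType d} {n : nat}.
Variable X : 'I_n -> T -> R.

(** [T] with the sigma-algebra generated by the vector X.  Measurability on this
    type is [g_sigma_preimage X], so the measurability lemmas also show that an
    event depends on X alone, which is what independence asks for. *)
Definition sigma_of :=
  g_sigma_algebraType (\big[setU/set0]_(i < n)
    preimage_set_system setT (X i) measurable).

Lemma measurable_sigma_of i :
  measurable_fun setT (X i : sigma_of -> R).
Proof.
move=> _ B mB; rewrite setTI; apply: sub_sigma_algebra.
rewrite -bigcup_seq/=; exists i => /=; first by rewrite mem_index_enum.
by exists B => //; rewrite setTI.
Qed.

End sigma_generated.
Arguments measurable_sigma_of {R d T n} X i.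

(** * Conditioning on a finite-valued variable *)

Section total_probability.
Context {R : realType} {d : measure_display} {T : measurableType d}
  {P : probability T R} {I : finType} (S : T -> I).
Hypothesis mS : forall i, measurable [set t | S t = i].

Lemma total_integral (f : T -> \bar R) :
    measurable_fun setT f -> (forall t, 0 <= f t)%E ->
  (\int[P]_t f t = \sum_(i : I) \int[P]_(t in [set t | S t = i]) f t)%E.
Proof.
move=> mf f0.
have cover : \big[setU/set0]_(i : I) [set t | S t = i] = setT.
  apply/seteqP; split => // t _; rewrite -bigcup_seq.
  by exists (S t) => //=; rewrite mem_index_enum.
rewrite -[in LHS]cover ge0_integral_bigsetU ?cover ?index_enum_uniq//.
by move=> i j _ _ [t [/= <- <-]].
Qed.

Lemma total_probability (B : set T) : measurable B ->
  (P B = \sum_(i : I) P ([set t | S t = i] `&` B))%E.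
Proof.
move=> mB; rewrite -[in LHS](setIT B) -integral_indic// total_integral//.
- by apply: eq_bigr => i _; rewrite integral_indic// setIC.
- by apply/measurable_EFinP; exact: measurable_indic.
Qed.

End total_probability.

(** Both sides are integrals of tail probabilities: for r >= 0 the event
    1_A W > r is the intersection of A with W > r, so its probability
    factorizes. *)
Lemma integral_independent_event {R : realType} {d : measure_display}
    {T : measurableType d} {P : probability T R} (A : set T) (W : T -> R) :
    measurable A -> measurable_fun setT W -> (forall t, 0 <= W t) ->
    (forall B : set R, measurable B ->
      P (A `&` W @^-1` B) = (P A * P (W @^-1` B))%E) ->
  (\int[P]_(t in A) (W t)%:E = P A * \int[P]_t (W t)%:E)%E.
Proof.
move=> mA mW W0 AW.
have mAW : measurable_fun setT (fun t => \1_A t * W t).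
  by apply: measurable_funM => //; exact: measurable_indic.
pose V : {RV P >-> R} := HB.pack W (isMeasurableFun.Build _ _ _ _ _ mW).
pose VA : {RV P >-> R} :=
  HB.pack (fun t => \1_A t * W t) (isMeasurableFun.Build _ _ _ _ _ mAW).
have EV : (\int[P]_t (W t)%:E = 'E_P[V])%E by rewrite unlock.
have EVA : (\int[P]_(t in A) (W t)%:E = 'E_P[VA])%E.
  rewrite unlock integral_mkcond; apply: eq_integral => t _ /=.
  rewrite patchE indicE; case: ifPn => _; first by rewrite mul1r.
  by rewrite mul0r.
rewrite EV EVA !ge0_expectation_ccdf//; last first.
  by move=> t; rewrite mulr_ge0// indicE ler0n.
rewrite -ge0_integralZl//; last first.
  by apply: measurable_funTS; exact: ccdf_measurable.
apply: eq_integral => r; rewrite inE/= in_itv/= andbT => r0.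
rewrite /ccdf /distribution /pushforward -AW//; congr (P _).
apply/seteqP; split => t /=; rewrite !in_itv/= !andbT indicE.
  case: (boolP (t \in A)) => [|_]; first by rewrite inE mul1r.
  by rewrite mul0r ltNge r0.
by move=> [/mem_set ->]; rewrite mul1r.
Qed.

(** * Vectors following a copula *)

Section copulas.
Context {R : realType} {n : nat}.
Implicit Types C : 'rV[R]_n -> R.

Definition margin_point (i : 'I_n) (a : R) : 'rV[R]_n :=
  \row_j (if j == i then a else 1).

Lemma unit_cube_margin_point i a : 0 <= a <= 1 -> unit_cube (margin_point i a).
Proof. by move=> a01 j; rewrite mxE; case: ifP => // _; rewrite ler01 lexx. Qed.

Lemma margin_pointP (i : 'I_n) (a : R) (y : 'I_n -> R) :
  (forall j, y j <= 1) ->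
  (forall j, y j <= margin_point i a 0 j) <-> y i <= a.
Proof.
move=> y1; split=> [/(_ i)|yia j]; first by rewrite mxE eqxx.
by rewrite mxE; case: eqP => [->|].
Qed.

(** The other coordinates of a vector with uniform margins are at most 1 almost
    surely, so at a [margin_point] the copula sees a single margin. *)
Lemma copula_margin C : copula C ->
  forall i a, 0 <= a <= 1 -> C (margin_point i a) = a.
Proof.
move=> [d [T [P [X [uX XC]]]]] i a a01.
have cdfX j b : 0 <= b <= 1 -> P [set t | X j t <= b] = b%:E.
  move=> b01; have -> : [set t | X j t <= b] = X j @^-1` `]-oo, b]%classic.
    by apply/seteqP; split => t; rewrite /= in_itv.
  by rewrite -[LHS]/(distribution P (X j) _) uX// uniform_prob_itvNyc.
have X1 : {ae P, forall t, forall j, X j t <= 1}.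
  apply: filter_forall => j; apply: probability1_ae.
    exact: measurable_set_le.
  by rewrite cdfX// ler01 lexx.
apply: EFin_inj; rewrite -XC; last exact: unit_cube_margin_point.
rewrite -(cdfX i)//; apply: ae_probability_eq.
- by apply: measurable_finite_forall => j; exact: measurable_set_le.
- exact: measurable_set_le.
- by apply: filterS X1 => t; exact: margin_pointP.
Qed.

Context {d : measure_display} {T : measurableType d} {P : probability T R}.
Variables (C : 'rV[R]_n -> R) (U : 'I_n -> {RV P >-> R}).
Hypotheses (C_copula : copula C) (U_C : follows U C).

(** A vector is tied to its copula on the cube only; the value of the copula at
    the corner (1,...,1) is 1, which confines the vector to ]-oo, 1]^n almost
    surely. *)
Lemma follows_le1 : {ae P, forall t, forall j, U j t <= 1}.
Proof.
apply: filter_forall => i.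
have U1 := U_C _ (unit_cube_margin_point i 1 _).
have : {ae P, forall t, forall j, U j t <= margin_point i 1 0 j}.
  apply: probability1_ae.
    by apply: measurable_finite_forall => j; exact: measurable_set_le.
  by rewrite U1 ?copula_margin// ler01 lexx.
by apply: filterS => t /(_ i); rewrite mxE eqxx.
Qed.

Lemma follows_margin i a : 0 <= a <= 1 -> P [set t | U i t <= a] = a%:E.
Proof.
move=> a01; rewrite -[in RHS](copula_margin C C_copula i a a01) -U_C; last first.
  exact: unit_cube_margin_point.
apply: ae_probability_eq.
- exact: measurable_set_le.
- by apply: measurable_finite_forall => j; exact: measurable_set_le.
- by apply: filterS follows_le1 => t /(margin_pointP i a) [? ?]; split.
Qed.

Lemma follows_gt0 : {ae P, forall t, forall j, 0 < U j t}.
Proof.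
apply: filter_forall => i; apply: (probability1_ae [set t | 0 < U i t]).
  exact: measurable_set_gt.
have -> : [set t | 0 < U i t] = ~` [set t | U i t <= 0].
  by apply/seteqP; split => t /=; rewrite ltNge => /negP.
rewrite probability_setC; last exact: measurable_set_le.
by rewrite follows_margin ?sube0// lexx ler01.
Qed.

End copulas.

(** * Independence and the law of the spliced vector *)

Section splice_events.
Context {R : realType} {d : measure_display} {T : measurableType d}.
Variables (a b : R) (X W : {mfun T >-> R}) (t : T).
Hypothesis a1 : a < 1.

Lemma splice_le_below : b <= a -> 0 < W t ->
  (splice a X W t <= b) = (X t <= b).
Proof.
move=> ba W0; rewrite /splice; case: leP => Xa.
  by rewrite mulr1 mulr0 addr0.
rewrite mulr0 mulr1 add0r (leNgt (X t)) (le_lt_trans ba Xa)/=.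
apply/negbTE; rewrite -ltNge (le_lt_trans ba)// ltrDl.
by rewrite mulr_gt0// subr_gt0.
Qed.

Lemma splice_le_above : a <= b ->
  (splice a X W t <= b) = ((a < X t) ==> (W t <= (b - a) / (1 - a))).
Proof.
move=> ab; rewrite /splice; case: leP => Xa /=.
  by rewrite mulr1 mulr0 addr0 (le_trans Xa ab).
by rewrite mulr0 mulr1 add0r -lerBrDl ler_pdivlMr ?subr_gt0// mulrC.
Qed.

End splice_events.

Section independence.
Context {R : realType} {d : measure_display} {T : measurableType d}
  {P : probability T R} {n : nat}.
Variables (U W : 'I_n -> {RV P >-> R}).
Hypothesis UW : independent_vectors U W.

Lemma independent_sigma_of (A B : set T) :
  @measurable _ (sigma_of (fun i => U i : T -> R)) A ->
  @measurable _ (sigma_of (fun i => W i : T -> R)) B ->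
  P (A `&` B) = (P A * P B)%E.
Proof. exact: UW. Qed.

Lemma independent_exceed (a : 'I_n -> R) J (B : set T) :
  @measurable _ (sigma_of (fun i => W i : T -> R)) B ->
  P ([set t | exceed a (fun i => U i : T -> R) t = J] `&` B) =
  (P [set t | exceed a (fun i => U i : T -> R) t = J] * P B)%E.
Proof.
apply: independent_sigma_of; apply: (@measurable_exceed _ _ (sigma_of _)).
exact: measurable_sigma_of.
Qed.

End independence.

Section splice_law.
Context {R : realType} {d : measure_display} {T : measurableType d}
  {P : probability T R} {n : nat}.
Variables (C CV : 'rV[R]_n -> R) (U V : 'I_n -> {RV P >-> R}) (u : 'rV[R]_n).
Hypotheses (C_copula : copula C) (U_C : follows U C).
Hypotheses (CV_copula : copula CV) (V_CV : follows V CV).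
Hypothesis UV_indep : independent_vectors U V.
Hypothesis u01 : forall i, 0 < u 0 i < 1.

Let u0 i : 0 < u 0 i. Proof. by have /andP[] := u01 i. Qed.
Let u1 i : u 0 i < 1. Proof. by have /andP[] := u01 i. Qed.

(** Above u_i the level b is reached from below u_i, with probability u_i, or by
    the independent V_i, with probability (1 - u_i) (b - u_i) / (1 - u_i). *)
Lemma splice_margin i (b : R) : 0 <= b <= 1 ->
  P [set t | splice_vector u U V i t <= b] = b%:E.
Proof.
move=> /andP[b0 b1]; have [bu|ub] := leP b (u 0 i).
  rewrite -(follows_margin C U C_copula U_C i b) ?b0//.
  apply: ae_probability_eq; [exact: measurable_set_le..|].
  apply: filterS (follows_gt0 CV V CV_copula V_CV) => t V0 /=.
  by rewrite splice_le_below.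
pose v := (b - u 0 i) / (1 - u 0 i).
have v01 : 0 <= v <= 1.
  have u1' : 0 < 1 - u 0 i by rewrite subr_gt0.
  by rewrite /v ler_pdivrMr// mul1r lerD2r b1 divr_ge0// ?subr_ge0 ltW.
have mS c : measurable [set t | (u 0 i < U i t) = c].
  case: c; first exact: measurable_set_gt.
  have := measurable_set_le (U i) (u 0 i) (measurable_funPT (U i)).
  congr measurable; apply/seteqP; split => t /=; rewrite leNgt.
    by move/negbTE.
  by move=> ->.
rewrite (total_probability (fun t => u 0 i < U i t) mS); last first.
  exact: measurable_set_le.
rewrite big_bool -[LHS]/(_ + _)%E.
have spliceE t : (splice (u 0 i) (U i) (V i) t <= b) =
    ((u 0 i < U i t) ==> (V i t <= v)).
  by apply: splice_le_above => //; exact: ltW.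
have -> : [set t | (u 0 i < U i t) = true] `&`
    [set t | splice_vector u U V i t <= b] =
    [set t | (u 0 i < U i t) = true] `&` [set t | V i t <= v].
  by apply/seteqP; split => t /= [Ut]; rewrite spliceE Ut.
have -> : [set t | (u 0 i < U i t) = false] `&`
    [set t | splice_vector u U V i t <= b] = [set t | U i t <= u 0 i].
  apply/seteqP; split => t /=; rewrite ?spliceE ltNge.
    by case=> /negbFE.
  by move=> ->.
rewrite (independent_sigma_of U V UV_indep); last 2 first.
- apply: (@measurable_set_gt _ _ (sigma_of _)).
  exact: (measurable_sigma_of _ i).
- apply: (@measurable_set_le _ _ (sigma_of _)).
  exact: (measurable_sigma_of _ i).
have -> : [set t | (u 0 i < U i t) = true] = ~` [set t | U i t <= u 0 i].
  by apply/seteqP; split => t /=; rewrite ltNge => /negP.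
rewrite probability_setC; last exact: measurable_set_le.
rewrite (follows_margin C U C_copula U_C i) ?(ltW (u0 i)) ?(ltW (u1 i))//.
rewrite (follows_margin CV V CV_copula V_CV i)//.
by rewrite -EFinB -EFinM -EFinD /v mulrCA divff ?mulr1 ?subrK// subr_eq0 gt_eqF.
Qed.

Lemma splice_copula :
  copula (fun w => fine (P [set t | forall i, splice_vector u U V i t <= w 0 i])).
Proof.
exists d, T, P, (splice_vector u U V); split; last first.
  move=> w _; rewrite fineK// fin_num_measure//.
  by apply: measurable_finite_forall => j; exact: measurable_set_le.
by move=> i A mA; apply: distribution_uniform => // b; exact: splice_margin.
Qed.

Lemma splice_below (w : 'rV[R]_n) : (forall i, w 0 i <= u 0 i) ->
  P [set t | forall i, splice_vector u U V i t <= w 0 i] =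
  P [set t | forall i, U i t <= w 0 i].
Proof.
move=> wu; apply: ae_probability_eq.
- by apply: measurable_finite_forall => j; exact: measurable_set_le.
- by apply: measurable_finite_forall => j; exact: measurable_set_le.
apply: filterS (follows_gt0 CV V CV_copula V_CV) => t V0 /=.
by split => H i; have := H i; rewrite splice_le_below.
Qed.

(** Coordinates outside of J impose no condition on V, which is expressed by
    the level 1: it is exceeded with probability 0 only. *)
Lemma splice_above (w : 'rV[R]_n) : (forall i, u 0 i <= w 0 i <= 1) ->
  P [set t | forall i, splice_vector u U V i t <= w 0 i] =
  (\sum_(J : {set 'I_n})
    P [set t | exceed (u 0%R) (fun i => U i : T -> R) t = J] *
    (CV (\row_j
      if j \in J then ((w 0 j - u 0 j) / (1 - u 0 j))%R else 1%R))%:E)%E.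
Proof.
move=> uw.
rewrite (total_probability (exceed (u 0) (fun i => U i : T -> R))); last 2 first.
- by move=> J; exact: measurable_exceed.
- by apply: measurable_finite_forall => j; exact: measurable_set_le.
apply: eq_bigr => J _.
pose v : 'rV[R]_n := \row_j if j \in J then (w 0 j - u 0 j) / (1 - u 0 j) else 1.
have v01 : unit_cube v.
  move=> j; rewrite mxE; case: ifP => _; last by rewrite ler01 lexx.
  have /andP[uwj wj1] := uw j.
  have u1' : 0 < 1 - u 0 j by rewrite subr_gt0.
  by rewrite ler_pdivrMr// mul1r lerD2r wj1 divr_ge0// ?subr_ge0// ltW.
rewrite -(V_CV v v01) -(independent_exceed U V UV_indep); last first.
  apply: (@measurable_finite_forall _ (sigma_of _)) => j.
  apply: (@measurable_set_le _ _ (sigma_of _)).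
  exact: (measurable_sigma_of _ j).
have mY : measurable [set t | forall i, splice_vector u U V i t <= w 0 i].
  by apply: measurable_finite_forall => j; exact: measurable_set_le.
have mJ : measurable [set t | exceed (u 0) (fun i => U i : T -> R) t = J].
  exact: measurable_exceed.
apply: ae_probability_eq.
- exact: measurableI.
- apply: measurableI => //.
  by apply: measurable_finite_forall => j; exact: measurable_set_le.
apply: filterS (follows_le1 CV V CV_copula V_CV) => t V1 /=.
have spliceE i : (splice_vector u U V i t <= w 0 i) =
    ((i \in exceed (u 0) (fun i => U i : T -> R) t) ==>
     (V i t <= (w 0 i - u 0 i) / (1 - u 0 i))).
  by rewrite inE splice_le_above//; have /andP[] := uw i.
split=> -[tJ H]; split => // i; have := H i; rewrite spliceE tJ mxE.
  by case: ifP.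
by case: ifP => // _ ->.
Qed.

End splice_law.

(** * The mixture of rescaled D-norms *)

Lemma is_norm_ge0 {R : realType} {n : nat} (N : 'rV[R]_n -> R) :
  is_norm N -> forall x, 0 <= N x.
Proof.
move=> [triangle hom _] x; have := triangle x (-1 *: x).
have -> : N (x + -1 *: x) = 0.
  by rewrite scaleN1r subrr -[X in N X](scale0r (0 : 'rV[R]_n)) hom normr0 mul0r.
by rewrite hom normrN1 mul1r -mulr2n pmulrn_lge0.
Qed.

(** At a unit vector the norm sees a single component of the generator, so the
    normalization E(Z_j) = 1 can be recovered from the norm alone. *)
Lemma expectation_max_delta {R : realType} {d : measure_display}
    {T : measurableType d} {P : probability T R} {n : nat}
    (Z : 'I_n -> {RV P >-> R}) (j : 'I_n) :
    {ae P, forall t, forall i, 0 <= Z i t} ->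
  'E_P[fun t => (\big[Order.max/0]_(i < n)
    (`|(delta_mx 0 j : 'rV[R]_n) 0 i| * Z i t))%R]%E = 'E_P[Z j]%E.
Proof.
move=> Z0; rewrite unlock; apply: ae_eq_integral => //.
- apply/measurable_EFinP.
  exact: (measurable_bigmax_scaled (fun i => `|(delta_mx 0 j : 'rV[R]_n) 0 i|)).
- exact/measurable_EFinP.
apply: filterS Z0 => t Zt _ /=; congr (_%:E); apply/le_anti/andP; split.
  apply: bigmax_le => // i _; rewrite mxE eqxx/=.
  by case: eqP => [->|_]; rewrite ?normr1 ?mul1r// normr0 mul0r.
apply: (bigmax_sup j) => //.
by rewrite mxE !eqxx normr1 mul1r.
Qed.

Section mixture_norm.
Context {R : realType} {d : measure_display} {T : measurableType d}
  {P : probability T R} {n : nat}.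
Variables (U : 'I_n -> {RV P >-> R}) (u : 'rV[R]_n).
Hypothesis u1 : forall i, u 0 i < 1.

Definition exceed_event (J : {set 'I_n}) : set T :=
  [set t | exceed (u 0) (fun i => U i : T -> R) t = J].

Definition exceed_prob (J : {set 'I_n}) : R := fine (P (exceed_event J)).

Definition rescale_on (J : {set 'I_n}) (x : 'rV[R]_n) : 'rV[R]_n :=
  \row_j (x 0 j / (1 - u 0 j) * (j \in J)%:R).

Definition mixture_norm (N : 'rV[R]_n -> R) (x : 'rV[R]_n) : R :=
  \sum_(J : {set 'I_n}) exceed_prob J * N (rescale_on J x).

Lemma measurable_exceed_event J : measurable (exceed_event J).
Proof. exact: measurable_exceed. Qed.

Lemma exceed_probE J : P (exceed_event J) = (exceed_prob J)%:E.
Proof.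
by rewrite fineK// fin_num_measure//; exact: measurable_exceed_event.
Qed.

Lemma exceed_prob_ge0 J : 0 <= exceed_prob J.
Proof. by rewrite fine_ge0. Qed.

Lemma sum_exceed_prob : \sum_J exceed_prob J = 1.
Proof.
apply: EFin_inj; rewrite -(probability_setT P).
rewrite (total_probability _ measurable_exceed_event)// -sumEFin.
by apply: eq_bigr => J _; rewrite setIT exceed_probE.
Qed.

Lemma sum_exceed_prob_in j :
  (\sum_J exceed_prob J * (j \in J)%:R)%:E = P [set t | u 0 j < U j t].
Proof.
rewrite (total_probability _ measurable_exceed_event); last first.
  exact: measurable_set_gt.
rewrite -sumEFin; apply: eq_bigr => J _.
have [jJ|jJ] := boolP (j \in J).
  rewrite mulr1 -exceed_probE; apply: (congr1 (P : set T -> \bar R)).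
  apply/seteqP; split => t /= => [tJ|[]//]; split => //.
  by move: jJ; rewrite -tJ inE.
rewrite mulr0 -[LHS](measure0 P); apply: (congr1 (P : set T -> \bar R)).
apply/seteqP; split => t //= -[tJ Ut].
by move: jJ; rewrite -tJ inE Ut.
Qed.

(** Definiteness comes from the term of the full set: there [rescale_on] is an
    invertible diagonal scaling, whereas for smaller sets it forgets
    coordinates. *)
Lemma is_norm_mixture (N : 'rV[R]_n -> R) :
    is_norm N -> 0 < exceed_prob [set: 'I_n]%SET ->
  is_norm (mixture_norm N).
Proof.
move=> Nnorm pT; have N0 := is_norm_ge0 N Nnorm.
case: Nnorm => triangle hom sep; split.
- move=> x y; rewrite /mixture_norm -big_split/=; apply: ler_sum => J _.
  rewrite -mulrDr ler_wpM2l ?exceed_prob_ge0//.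
  have -> : rescale_on J (x + y) = rescale_on J x + rescale_on J y.
    by apply/rowP => j; rewrite !mxE !mulrDl.
  exact: triangle.
- move=> a x; rewrite /mixture_norm mulr_sumr; apply: eq_bigr => J _.
  have -> : rescale_on J (a *: x) = a *: rescale_on J x.
    by apply/rowP => j; rewrite !mxE !mulrA.
  by rewrite hom mulrCA.
- move=> x /eqP; rewrite psumr_eq0; last first.
    by move=> J _; rewrite mulr_ge0// exceed_prob_ge0.
  move=> /allP/(_ [set: 'I_n]%SET); rewrite mem_index_enum => /(_ isT)/=.
  rewrite mulf_eq0 gt_eqF//= => /eqP/sep/rowP x0.
  apply/rowP => j; have := x0 j; rewrite !mxE inE mulr1 => /eqP.
  by rewrite mulf_eq0 invr_eq0 subr_eq0 (gt_eqF (u1 j)) orbF => /eqP.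
Qed.

Lemma mixture_norm_delta (N : 'rV[R]_n -> R) j : is_norm N ->
  (mixture_norm N (delta_mx 0 j))%:E =
  (P [set t | (u 0 j < U j t)%R] * (N (delta_mx 0 j) / (1 - u 0 j))%R%:E)%E.
Proof.
move=> [_ hom _]; rewrite -sum_exceed_prob_in -EFinM mulr_suml.
congr (_%:E); apply: eq_bigr => J _; rewrite -mulrA; congr (_ * _).
have -> : rescale_on J (delta_mx 0 j) =
    ((j \in J)%:R / (1 - u 0 j)) *: delta_mx 0 j.
  apply/rowP => i; rewrite !mxE eqxx/=.
  by case: eqP => [->|_]; rewrite ?mulr0 ?mul0r// mul1r mulr1 mulrC.
rewrite hom ger0_norm; last by rewrite divr_ge0// subr_ge0 ltW.
by rewrite -mulrA [X in _ * X]mulrC.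
Qed.

Lemma measurable_thinning (Z : {RV P >-> R}) j :
  measurable_fun setT (fun t => Z t * ((u 0 j < U j t)%R%:R / (1 - u 0 j))).
Proof.
apply: measurable_funM => //; apply: measurable_funM; last exact: measurable_cst.
have := @measurable_indic _ T R setT _
  (measurable_set_gt (U j) (u 0 j) (measurable_funPT (U j))).
congr measurable_fun; apply/funext => t.
by rewrite indicE; congr (_%:R); congr nat_of_bool; apply/idP/idP; rewrite inE.
Qed.

(** On the event J = K the random vector 1(U_j > u_j) / (1 - u_j) is constant,
    which makes the maximum a function of Z alone; this function is then
    integrated over an event independent of it. *)
Lemma mixture_norm_expectation (Z : 'I_n -> {RV P >-> R}) (N : 'rV[R]_n -> R) :
    independent_vectors U Z ->
    (forall x, (N x)%:E =
      'E_P[fun t => (\big[Order.max/0]_(i < n) (`|x 0 i| * Z i t))%R]%E) ->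
  forall x, (mixture_norm N x)%:E =
    'E_P[fun t => (\big[Order.max/0]_(j < n)
      (`|x 0 j| * Z j t * ((u 0 j < U j t)%R%:R / (1 - u 0 j))))%R]%E.
Proof.
move=> UZ NE x.
have thinE J t : exceed_event J t ->
    \big[Order.max/0]_(j < n)
      (`|x 0 j| * Z j t * ((u 0 j < U j t)%R%:R / (1 - u 0 j))) =
    \big[Order.max/0]_(j < n) (`|rescale_on J x 0 j| * Z j t).
  move=> <-; apply: eq_bigr => j _.
  rewrite mxE inE !normrM normfV [`|1 - _|]gtr0_norm ?subr_gt0//.
  rewrite normr_nat -!mulrA; congr (_ * _).
  by rewrite [LHS]mulrC [X in X * _]mulrC mulrA.
have mthin : measurable_fun setT (fun t => \big[Order.max/0]_(j < n)
      (`|x 0 j| * Z j t * ((u 0 j < U j t)%R%:R / (1 - u 0 j)))).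
  under eq_fun do under eq_bigr do rewrite -mulrA.
  apply: (measurable_bigmax_scaled (fun j => `|x 0 j|)
    (fun j t => Z j t * ((u 0 j < U j t)%R%:R / (1 - u 0 j)))) => j.
  exact: measurable_thinning.
rewrite unlock (total_integral _ measurable_exceed_event); last 2 first.
- exact/measurable_EFinP.
- by move=> t; rewrite lee_fin bigmax_ge_id.
rewrite -sumEFin; apply: eq_bigr => J _.
rewrite (eq_integral (fun t =>
  (\big[Order.max/0]_(j < n) (`|rescale_on J x 0 j| * Z j t))%:E)); last first.
  by move=> t; rewrite inE => /thinE ->.
rewrite integral_independent_event.
- by rewrite EFinM exceed_probE NE unlock.
- exact: measurable_exceed_event.
- exact: (measurable_bigmax_scaled (fun j => `|rescale_on J x 0 j|)).
- by move=> t; rewrite bigmax_ge_id.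
move=> B mB; apply: (independent_exceed U Z UZ).
have mW : measurable_fun setT ((fun t => \big[Order.max/0]_(j < n)
    (`|rescale_on J x 0 j| * Z j t)) : sigma_of (fun i => Z i : T -> R) -> R).
  apply: (@measurable_bigmax_scaled _ _ (sigma_of _)).
  exact: measurable_sigma_of.
by rewrite -[X in measurable X]setTI; exact: mW.
Qed.

End mixture_norm.

(** The generator is Z_j 1(U_j > u_j) / (1 - u_j).  Its mean is taken from the
    norm at a unit vector: only the sets containing j contribute, with total
    weight P(U_j > u_j) = 1 - u_j. *)
Lemma Dnorm_mixture {R : realType} {d : measure_display} {T : measurableType d}
    {P : probability T R} {n : nat} (C NV : 'rV[R]_n -> R)
    (U Z : 'I_n -> {RV P >-> R}) (u : 'rV[R]_n) :
    copula C -> follows U C -> is_norm NV -> Dnorm_generator Z NV ->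
    (forall i, 0 < u 0 i < 1) ->
    (0 < P [set t | forall i, (u 0 i < U i t)%R])%E ->
    independent_vectors U Z ->
  Dnorm (mixture_norm U u NV).
Proof.
move=> C_copula U_C NV_norm [[c c0 Zc] EZ NVE] u01 PU UZ.
have u1 i : u 0 i < 1 by have /andP[] := u01 i.
have u1' i : 0 < 1 - u 0 i by rewrite subr_gt0.
have PE : 0 < exceed_prob U u [set: 'I_n]%SET.
  rewrite -lte_fin -exceed_probE; move: PU; congr (0 < P _)%E.
  apply/seteqP; split => t /=.
    by move=> Ut; apply/setP => i; rewrite !inE Ut.
  by move=> /setP Ut i; have := Ut i; rewrite !inE.
pose Z' j : {RV P >-> R} :=
  HB.pack (fun t => Z j t * ((u 0 j < U j t)%R%:R / (1 - u 0 j)))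
    (isMeasurableFun.Build _ _ _ _ _ (measurable_thinning U u (Z j) j)).
have Z'0 : {ae P, forall t, forall i, 0 <= Z' i t}.
  apply: filterS Zc => t Zt i /=; have /andP[Z0 _] := Zt i.
  by rewrite mulr_ge0// divr_ge0 ?ler0n ?(ltW (u1' i)).
have NYE x : (mixture_norm U u NV x)%:E =
    'E_P[fun t => (\big[Order.max/0]_(i < n) (`|x 0 i| * Z' i t))%R]%E.
  rewrite (mixture_norm_expectation U u u1 Z NV UZ NVE).
  congr (expectation _ _); apply/funext => t.
  by apply: eq_bigr => i _; rewrite -[LHS]mulrA.
split; first exact: is_norm_mixture.
exists d, T, P, Z'; split => //.
- exists (c * \big[Order.max/1]_(i < n) (1 - u 0 i)^-1).
    by rewrite mulr_gt0// (lt_le_trans ltr01)// bigmax_ge_id.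
  apply: filterS2 Zc Z'0 => t Zt Z't i; rewrite Z't/=.
  have /andP[Z0 Zic] := Zt i.
  apply: ler_pM => //; first by rewrite divr_ge0 ?ler0n ?(ltW (u1' i)).
  apply: (bigmax_sup i) => //.
  by rewrite ler_piMl ?invr_ge0 ?(ltW (u1' i))//; case: (_ < _).
- move=> j; rewrite -(expectation_max_delta Z' j Z'0) -NYE mixture_norm_delta//.
  have -> : [set t | u 0 j < U j t] = ~` [set t | U j t <= u 0 j].
    by apply/seteqP; split => t /=; rewrite ltNge => /negP.
  rewrite probability_setC; last exact: measurable_set_le.
  have /andP[/ltW u0j /ltW u1j] := u01 j.
  rewrite (follows_margin C U C_copula U_C) ?u0j//.
  have -> : NV (delta_mx 0 j) = 1.
    apply: EFin_inj; rewrite NVE expectation_max_delta ?EZ//.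
    by apply: filterS Zc => t Zt i; have /andP[] := Zt i.
  by rewrite -EFinB -EFinM mulrCA divff ?mulr1// gt_eqF.
Qed.

Theorem theorem3p1 (R : realType) (d : measure_display) (T : measurableType d)
    (P : probability T R) (n : nat) (n_gt0 : (0 < n)%N)
    (C CV NV : 'rV[R]_n -> R) (U V Z : 'I_n -> {RV P >-> R}) (u : 'rV[R]_n)
    (C_copula : copula C) (U_C : follows U C)
    (CV_gpd : gpd_copula CV NV) (V_CV : follows V CV)
    (Z_gen : Dnorm_generator Z NV)
    (UV_indep : independent_vectors U V)
    (u01 : forall i, 0 < u 0 i < 1)
    (PU : (0 < P [set t | forall i, (u 0 i < U i t)%R])%E)
    (UZ_indep : independent_vectors U Z) :
  exists CY NY : 'rV[R]_n -> R,
    [/\ gpd_copula CY NY,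
        follows (splice_vector u U V) CY,
        forall w : 'rV[R]_n, (forall i, 0 <= w 0 i <= u 0 i) -> CY w = C w &
        forall x : 'rV[R]_n, (NY x)%:E =
          'E_P[fun t => (\big[Order.max/0]_(j < n)
                 (`|x 0 j| * Z j t * ((u 0 j < U j t)%R%:R / (1 - u 0 j))))%R]%E].
Proof.
have u1 i : u 0 i < 1 by have /andP[] := u01 i.
have u1' i : 0 < 1 - u 0 i by rewrite subr_gt0.
case: CV_gpd => CV_copula [NV_norm _] [v0 v01 CVE].
exists (fun w => fine (P [set t | forall i, splice_vector u U V i t <= w 0 i])),
  (mixture_norm U u NV); split.
- split; first exact: (splice_copula C CV).
    exact: (Dnorm_mixture C NV U Z).
  (* The rescaling v must reach the region of the representation of [CV] and
     also stay in the cube, whence the maximum with 0. *)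
  exists (\row_i (u 0 i + (1 - u 0 i) * Order.max 0 (v0 0 i))).
    move=> i; rewrite mxE -ltrBrDl -[ltRHS]mulr1 ltr_pM2l// gt_max ltr01.
    exact: v01.
  move=> w w01 ww.
  pose v i := (w 0 i - u 0 i) / (1 - u 0 i).
  have vmax i : Order.max 0 (v0 0 i) <= v i.
    by rewrite ler_pdivlMr// mulrC lerBrDl (le_trans _ (ww i))// mxE.
  have v0' i : 0 <= v i by have := vmax i; rewrite ge_max => /andP[].
  have v1 i : v i <= 1.
    by rewrite ler_pdivrMr// mul1r lerD2r; have /andP[_ ->] := w01 i.
  have uw i : u 0 i <= w 0 i <= 1.
    have /andP[_ ->] := w01 i; rewrite andbT (le_trans _ (ww i))//.
    by rewrite mxE lerDl mulr_ge0 ?(ltW (u1' i))// le_max lexx.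
  rewrite (splice_above CV)//.
  have CVvE (J : {set 'I_n}) : CV (\row_j (if j \in J then v j else 1)) =
      1 - NV (rescale_on u J (w - const_mx 1)).
    rewrite CVE.
    + congr (1 - NV _); apply/rowP => j; rewrite !mxE.
      case: ifP => _; last by rewrite mulr0 subrr.
      rewrite mulr1 -[X in v j - X](divff (lt0r_neq0 (u1' j))) -mulrBl.
      by congr (_ / _); rewrite opprB addrA subrK.
    + by move=> j; rewrite mxE; case: ifP; rewrite ?v0' ?v1 ?ler01 ?lexx.
    + move=> j; rewrite mxE; case: ifP => _; last exact: ltW.
      by have := vmax j; rewrite ge_max => /andP[].
  under eq_bigr do rewrite [P _]exceed_probE CVvE -EFinM mulrBr mulr1.
  by rewrite sumEFin/= sumrB sum_exceed_prob.
- move=> w w01; rewrite fineK// fin_num_measure//.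
  by apply: measurable_finite_forall => j; exact: measurable_set_le.
- move=> w w0u; rewrite (splice_below CV)//; last first.
    by move=> i; have /andP[] := w0u i.
  rewrite U_C// => i; have /andP[-> wu] := w0u i.
  exact: le_trans wu (ltW (u1 i)).
- have [_ _ NVE] := Z_gen.
  exact: (mixture_norm_expectation U u u1 Z NV UZ_indep NVE).
Qed.
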